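(* For $n\ge1$ and $i\ge0$ let $\mathcal{C}_{(\geq,\geq)}(n,i)$ be the set of Catalan words of length $n$ avoiding the pattern $(\geq,\geq)$ with last letter $i$, and define \[ C_i^{\geq}(x;q)=\sum_{n\geq 1}x^n \sum_{w\in \mathcal{C}_{(\geq, \geq)}(n,i)}q^{\mathrm{inter}(w)},\qquad C^{\geq}(x;q;v)=\sum_{i \geq 0}C_i^{\geq}(x;q)v^{i}. \] Then \[ C^{\geq}(x;q;v)=x+x^2+\frac{x^2}{1-qv}C^{\geq}(x;q;q)+xv\,C^{\geq}(x;q;qv)-\frac{x^2q^2v^2}{1-qv}C^{\geq}(x;q;q^2 v). \]
   Context: A Catalan word of length $n\ge 0$ is a sequence $w=w_1\cdots w_n$ of non-negative integers with $w_1=0$ and $0\le w_i\le w_{i-1}+1$ for $i=2,\dots,n$. It avoids the pattern $(\geq,\geq)$ if there is no index $i$ with $w_i\ge w_{i+1}\ge w_{i+2}$. To $w$ is associated the polyomino $P(w)$ with $n$ bottom-aligned columns, the $i$-th column consisting of $w_i+1$ unit cells. $\mathrm{inter}(w)$ is the number of interior points of $P(w)$, i.e. lattice points that belong to exactly four cells of $P(w)$. *)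

(* Defs.v *)
From HB Require Import structures.
From mathcomp Require Import all_boot all_order all_algebra finmap.
From mathcomp Require Import zify.
From mathcomp Require Import boolp classical_sets functions cardinality fsbigop.

Set Implicit Arguments.
Unset Strict Implicit.
Unset Printing Implicit Defensive.

Import GRing.Theory.
Local Open Scope classical_set_scope.
Local Open Scope ring_scope.

Record fps (K : Type) := Fps { coef : nat -> K }.

HB.instance Definition _ (K : Type) := gen_eqMixin (fps K).
HB.instance Definition _ (K : Type) := gen_choiceMixin (fps K).

Lemma fpsP (K : Type) (f g : fps K) : (forall n, coef f n = coef g n) <-> f = g.
Proof.
split=> [|-> //]; case: f g => [f] [g] /= fg; congr Fps; exact/funext.
Qed.

Section FpsRing.
Variable K : comNzRingType.
Implicit Types f g h : fps K.

Definition fps_zero : fps K := Fps (fun=> 0).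
Definition fps_opp f : fps K := Fps (fun n => - coef f n).
Definition fps_add f g : fps K := Fps (fun n => coef f n + coef g n).

Fact fps_addA : associative fps_add.
Proof. by move=> f g h; apply/fpsP => n /=; rewrite addrA. Qed.
Fact fps_addC : commutative fps_add.
Proof. by move=> f g; apply/fpsP => n /=; rewrite addrC. Qed.
Fact fps_add0 : left_id fps_zero fps_add.
Proof. by move=> f; apply/fpsP => n /=; rewrite add0r. Qed.
Fact fps_addN : left_inverse fps_zero fps_opp fps_add.
Proof. by move=> f; apply/fpsP => n /=; rewrite addNr. Qed.

HB.instance Definition _ :=
  GRing.isZmodule.Build (fps K) fps_addA fps_addC fps_add0 fps_addN.

Definition fps_one : fps K := Fps (fun n => (n == 0%N)%:R).
Definition fps_mul f g : fps K :=
  Fps (fun n => \sum_(i < n.+1) coef f i * coef g (n - i)).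

Let trunc n f : {poly K} := \poly_(i < n.+1) coef f i.

Let coef_trunc n f i : (i <= n)%N -> (trunc n f)`_i = coef f i.
Proof. by move=> le_in; rewrite coef_poly ltnS le_in. Qed.

Let coef_truncM n f g i :
  (i <= n)%N -> (trunc n f * trunc n g)`_i = coef (fps_mul f g) i.
Proof.
move=> le_in; rewrite coefM /=; apply: eq_bigr => j _.
rewrite !coef_trunc //; first exact: leq_trans (leq_subr _ _) le_in.
by apply: leq_trans le_in; rewrite -ltnS.
Qed.

Fact fps_mulA : associative fps_mul.
Proof.
move=> f g h; apply/fpsP => n.
transitivity (trunc n f * (trunc n g * trunc n h))`_n.
  rewrite coefM /=; apply: eq_bigr => j _.
  rewrite coef_trunc; last by rewrite -ltnS.
  by rewrite coef_truncM ?leq_subr.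
rewrite mulrA coefM /=; apply: eq_bigr => j _.
by rewrite coef_truncM ?coef_trunc ?leq_subr // -ltnS.
Qed.

Fact fps_mulC : commutative fps_mul.
Proof.
by move=> f g; apply/fpsP => n; rewrite -!(@coef_truncM n) // mulrC.
Qed.

Fact fps_mul1 : left_id fps_one fps_mul.
Proof.
move=> f; apply/fpsP => n /=.
by rewrite big_ord_recl /= mul1r subn0 big1 ?addr0 // => i _; rewrite mul0r.
Qed.

Fact fps_mulDl : left_distributive fps_mul fps_add.
Proof.
move=> f g h; apply/fpsP => n /=; rewrite -big_split /=.
by apply: eq_bigr => i _; rewrite mulrDl.
Qed.

Fact fps_one_neq0 : fps_one != 0.
Proof. by apply/eqP => /fpsP/(_ 0)/eqP /=; rewrite oner_eq0. Qed.

HB.instance Definition _ := GRing.Zmodule_isComNzRing.Build (fps K)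
  fps_mulA fps_mulC fps_mul1 fps_mulDl fps_one_neq0.

Definition fps_scale (a : K) f : fps K := Fps (fun n => a * coef f n).

Fact fps_scaleA a b f : fps_scale a (fps_scale b f) = fps_scale (a * b) f.
Proof. by apply/fpsP => n /=; rewrite mulrA. Qed.
Fact fps_scale1 : left_id 1 fps_scale.
Proof. by move=> f; apply/fpsP => n /=; rewrite mul1r. Qed.
Fact fps_scaleDr : right_distributive fps_scale +%R.
Proof. by move=> a f g; apply/fpsP => n /=; rewrite mulrDr. Qed.
Fact fps_scaleDl f : {morph fps_scale^~ f : a b / a + b}.
Proof. by move=> a b; apply/fpsP => n /=; rewrite mulrDl. Qed.

HB.instance Definition _ := GRing.Zmodule_isLmodule.Build K (fps K)
  fps_scaleA fps_scale1 fps_scaleDr fps_scaleDl.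

Fact fps_scaleAl (a : K) f g : a *: (f * g) = (a *: f) * g.
Proof.
apply/fpsP => n /=; rewrite big_distrr /=.
by apply: eq_bigr => i _; rewrite mulrA.
Qed.

HB.instance Definition _ :=
  GRing.Lmodule_isLalgebra.Build K (fps K) fps_scaleAl.

Fact fps_scaleAr (a : K) f g : a *: (f * g) = f * (a *: g).
Proof. by rewrite mulrC fps_scaleAl mulrC. Qed.

HB.instance Definition _ :=
  GRing.Lalgebra_isAlgebra.Build K (fps K) fps_scaleAr.

Definition fps_X : fps K := Fps (fun n => (n == 1%N)%:R).

(* The sum of a sequence of series such that, for each n, only finitely many
   of them have a nonzero coefficient of x^n. *)
Definition fps_sum (F : nat -> fps K) : fps K :=
  Fps (fun n => \sum_(i \in [set: nat]) coef (F i) n).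

End FpsRing.

Arguments fps_X {K}.

Local Close Scope ring_scope.

Definition catalan (w : seq nat) : Prop :=
  nth 0 w 0 = 0 /\
  forall i, i.+1 < size w -> nth 0 w i.+1 <= (nth 0 w i).+1.

Definition avoids_ge_ge (w : seq nat) : Prop :=
  ~ exists i, [/\ i.+2 < size w, nth 0 w i >= nth 0 w i.+1
                & nth 0 w i.+1 >= nth 0 w i.+2].

(* A cell is represented by its lower left corner: (a, b) stands for the closed
   unit square [a, a + 1] x [b, b + 1]. *)
Definition cells (w : seq nat) : seq (nat * nat) :=
  [seq (a, b) | a <- iota 0 (size w), b <- iota 0 (nth 0 w a).+1].

Definition in_cell (p c : nat * nat) : bool :=
  (c.1 <= p.1 <= c.1.+1) && (c.2 <= p.2 <= c.2.+1).

(* All the cells lie in the first quadrant, hence so do their points. *)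
Definition interior_points (w : seq nat) : set (nat * nat) :=
  [set p | count (in_cell p) (cells w) = 4].

Definition inter (w : seq nat) : nat := #|` fset_set (interior_points w)|%fset.

Definition catalan_ge_ge (n i : nat) : set (seq nat) :=
  [set w | [/\ size w = n, catalan w, avoids_ge_ge w & last 0 w = i]].

Local Open Scope ring_scope.

Definition C_last (K : comNzRingType) (q : K) (i : nat) : fps K :=
  Fps (fun n => if n == 0%N then 0
                else \sum_(w \in catalan_ge_ge n i) q ^+ inter w).

(* As a series in x, the coefficients are polynomials in q and v, so q and v can
   be any elements of a commutative ring; in the ring of rational functions in
   q and v (or of formal power series in q and v) they are indeterminates. *)
Definition C_ge (K : comNzRingType) (q v : K) : fps K :=
  fps_sum (fun i => v ^+ i *: C_last q i).

Local Close Scope ring_scope.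

(* [fset_set] is empty and [\sum_(_ \in _)] is 0 by convention in the infinite
   case; the lemmas below show that it does not occur in [inter], [C_last] and
   [C_ge]. *)

Lemma cells_uniq w : uniq (cells w).
Proof.
rewrite /cells; apply: allpairs_uniq_dep; rewrite ?iota_uniq //.
  by move=> a _; rewrite iota_uniq.
by move=> [a b] [a' b'] _ _ /= [-> ->].
Qed.

Lemma finite_interior_points w : finite_set (interior_points w).
Proof.
pose s := flatten [seq [:: (c.1, c.2); (c.1, c.2.+1); (c.1.+1, c.2);
                           (c.1.+1, c.2.+1)] | c <- cells w].
apply: (@sub_finite_set _ _ [set` s]); last exact: finite_seq.
move=> [x y] /= h.
have /hasP[[a b] cw /andP[/= xa yb]] : has (in_cell (x, y)) (cells w).
  by rewrite has_count h.
apply/flatten_mapP; exists (a, b) => //=; rewrite !inE !xpair_eqE.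
have [->|->] : x = a \/ x = a.+1 by lia.
all: have [->|->] : y = b \/ y = b.+1 by lia.
all: by rewrite !eqxx ?orbT.
Qed.

Lemma catalan_nth_le w i : catalan w -> (nth 0 w i <= i)%N.
Proof.
move=> [w0 wS]; elim: i => [|i IH]; first by rewrite w0.
have [lt_i|ge_i] := ltnP i.+1 (size w); last by rewrite nth_default.
exact: leq_trans (wS _ lt_i) _.
Qed.

Lemma finite_catalan_ge_ge n i : finite_set (catalan_ge_ge n i).
Proof.
pose f (t : n.-tuple 'I_n) : seq nat := [seq val j | j <- t].
apply: (@sub_finite_set _ _ (range f)); last first.
  exact/finite_image/finite_finset.
move=> w [sz_w cat_w _ _]; case: n => [|n] in f sz_w *.
  by exists [tuple] => //; rewrite /f /=; case: w sz_w {cat_w}.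
exists [tuple inord (nth 0 w j) | j < n.+1] => //.
apply: (@eq_from_nth _ 0) => [|j]; rewrite size_map size_tuple ?sz_w // => lt_j.
rewrite (nth_map ord0) ?size_tuple // -[j]/(val (Ordinal lt_j)) -tnth_nth.
by rewrite tnth_mktuple /= inordK // ltnS (leq_trans (catalan_nth_le _ cat_w)).
Qed.

Local Open Scope ring_scope.

Lemma coef_C_last_eq0 (K : comNzRingType) (q : K) i n :
  (n <= i)%N -> coef (C_last q i) n = 0.
Proof.
move=> le_ni /=; case: eqP => // n_neq0; rewrite fsbig1 // => w.
case=> sz_w cat_w _ last_w; have := catalan_nth_le (size w).-1 cat_w.
by rewrite nth_last last_w sz_w; lia.
Qed.

(* Main.v *)
(* Interior points of P(w) lie on the vertical line between two consecutive
   columns, so inter(w) is the sum of the min(w_i, w_(i+1)). An avoiding word of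
   length at least 3 ends either with an ascent j, j+1, which adds j to inter, or
   with j, j+1, i where i <= j+1, which adds j + i to inter. Summing over i gives
   q^j (1 - (qv)^(j+2)) / (1 - qv), whence the two terms in C(q) and C(q^2 v). *)
Require Import Defs.
From mathcomp Require Import all_boot all_algebra.
From mathcomp Require Import finmap zify ring.
From mathcomp Require Import boolp classical_sets functions cardinality fsbigop.
Import GRing.Theory.

(** * Interior points, column by column *)

Lemma mem_cells (w : seq nat) x y :
  ((x, y) \in cells w) = (x < size w) && (y <= nth 0 w x).
Proof.
apply/allpairsPdep/andP => [[a [b [+ + [-> ->]]]]|[x_lt y_le]].
  by rewrite !mem_iota !add0n ltnS => /andP[_ ->] /andP[_ ->].
by exists x, y; rewrite !mem_iota !add0n ltnS x_lt y_le.
Qed.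

(* A point belongs to at most four unit cells, so it is interior exactly when
   all of them are present. *)
Lemma interior_pointsE (w : seq nat) x y :
  interior_points w (x, y) <->
  [/\ 0 < x, 0 < y, x < size w & y <= minn (nth 0 w x.-1) (nth 0 w x)].
Proof.
pose L := [:: (x.-1, y.-1); (x.-1, y); (x, y.-1); (x, y)].
have uF : uniq (filter (in_cell (x, y)) (cells w)).
  exact/filter_uniq/cells_uniq.
have sub : {subset filter (in_cell (x, y)) (cells w) <= L}.
  move=> [a b]; rewrite mem_filter !inE !xpair_eqE /in_cell /=.
  by case/andP => H _; lia.
rewrite /interior_points /= -size_filter; split=> [sz4|[x0 y0 xw yw]].
  (* Four distinct cells inside the four-entry list [L] exhaust it and force its entries to be
     distinct. Distinctness excludes [x = 0] and [y = 0], where the truncated predecessor makes two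
     entries coincide. *)
  have uL : uniq L := leq_size_uniq uF sub (eq_leq (esym sz4)).
  have [_ eqL] := uniq_min_size uF sub (eq_leq (esym sz4)).
  have cw c : c \in L -> c \in cells w by rewrite -eqL mem_filter => /andP[].
  have := cw (x, y); have := cw (x.-1, y).
  rewrite !mem_cells !inE !eqxx !orbT => /(_ isT)/andP[_ y1] /(_ isT)/andP[xs y2].
  by move: uL; rewrite /= !inE !xpair_eqE; split; lia.
have uL : uniq L by rewrite /= !inE !xpair_eqE; lia.
have /perm_size -> // : perm_eq (filter (in_cell (x, y)) (cells w)) L.
apply: uniq_perm => // -[a b]; apply/idP/idP => [/sub //|].
rewrite mem_filter mem_cells /in_cell !inE !xpair_eqE /=.
by case/or4P => /andP[/eqP -> /eqP ->]; lia.
Qed.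

Lemma interE (w : seq nat) :
  inter w = \sum_(i < (size w).-1) minn (nth 0 w i) (nth 0 w i.+1).
Proof.
(* The shift by one in both coordinates skips the left edge and the base of the polyomino, which
   carry no interior point. *)
pose s := [seq (i.+1, j.+1) | i <- iota 0 (size w).-1,
                              j <- iota 0 (minn (nth 0 w i) (nth 0 w i.+1))].
have us : uniq s.
  apply: allpairs_uniq_dep; rewrite ?iota_uniq //.
    by move=> a _; rewrite iota_uniq.
  by move=> [a b] [a' b'] _ _ /= [-> ->].
rewrite /inter.
have -> : interior_points w = [set` [fset p in s]%fset]%classic.
  apply/seteqP; split => -[x y].
    rewrite interior_pointsE => -[x0 y0 xw yw] /=; rewrite inE /=.
    apply/allpairsPdep; exists x.-1, y.-1; rewrite !mem_iota !prednK //.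
    by split=> //; lia.
  rewrite /= inE /= => /allpairsPdep[a [b []]]; rewrite !mem_iota => ha hb [-> ->].
  by apply/interior_pointsE => /=; split=> //; lia.
rewrite set_fsetK card_fseq undup_id // size_allpairs_dep sumnE big_map.
by rewrite -(big_mkord xpredT (fun i => minn (nth 0 w i) (nth 0 w i.+1)))
           /index_iota subn0; apply: eq_bigr => i _; rewrite size_iota.
Qed.

Lemma inter_small (w : seq nat) : size w <= 1 -> inter w = 0.
Proof. by rewrite interE => sz; rewrite big1 // => -[i]; lia. Qed.

Lemma inter_rcons (w : seq nat) b :
  0 < size w -> inter (rcons w b) = inter w + minn (last 0 w) b.
Proof.
rewrite !interE size_rcons; case: (size w) (nth_last 0 w) (nth_rcons 0 w b) => //= n.
move=> nl nr _; rewrite big_ord_recr /= !nr ltnSn ltnn eqxx nl; congr (_ + _).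
by apply: eq_bigr => i _; rewrite !nr ltnS (ltnW (ltn_ord i)) ltnS ltn_ord.
Qed.

(** * Enumeration of the avoiding Catalan words *)

(* The largest letter that may follow a Catalan word; it is 0 for the empty
   word, which lets [words] below produce the word 00 without a special case. *)
Definition height (w : seq nat) := if nilp w then 0 else (last 0 w).+1.

Definition up w := rcons w (height w).

Lemma height_rcons w a : height (rcons w a) = a.+1.
Proof. by rewrite /height /nilp size_rcons last_rcons. Qed.

Lemma catalan_rcons w a :
  catalan (rcons w a) <-> catalan w /\ a <= height w.
Proof.
rewrite /catalan size_rcons /height /nilp -nth_last.
have nr i : nth 0 (rcons w a) i =
    if i < size w then nth 0 w i else if i == size w then a else 0.
  exact: nth_rcons.
case: (posnP (size w)) => [w0|w_gt0].
  rewrite nr w0 /=; have -> : w = [::] by case: w w0 {nr}.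
  by split=> [[->]|[[_ _]]]; [|rewrite leqn0 => /eqP ->].
split=> [[h0 hS]|[[h0 hS] ha]].
  split; first split.
  - by move: h0; rewrite nr w_gt0.
  - by move=> i lt_i; have := hS i; rewrite !nr lt_i (ltnW lt_i) ltnS (ltnW lt_i); apply.
  - have := hS (size w).-1; rewrite !nr prednK // ltnSn eqxx ltnn leqnn.
    by apply.
split=> [|i]; first by rewrite nr w_gt0.
rewrite ltnS !nr => lt_i; rewrite lt_i; case: ltnP => [/hS//|le_i].
have -> : i.+1 = size w by lia.
by rewrite eqxx (_ : i = (size w).-1) //; lia.
Qed.

Lemma avoids_small (w : seq nat) : size w <= 2 -> avoids_ge_ge w.
Proof. by move=> sz [i []]; lia. Qed.

(** Only the last triple is new. The guard [0 < size w] matters because [last 0] of the empty word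
    is 0, which would otherwise rule out the word 00. *)
Lemma avoids_rcons2 w a b :
  avoids_ge_ge (rcons (rcons w a) b) <->
  avoids_ge_ge (rcons w a) /\ ~~ ((0 < size w) && (b <= a <= last 0 w)).
Proof.
set u := rcons w a.
have nr i : i < size u -> nth 0 (rcons u b) i = nth 0 u i.
  by move=> lt_i; rewrite nth_rcons lt_i.
have su : size u = (size w).+1 by rewrite size_rcons.
have ub : nth 0 (rcons u b) (size w).+1 = b by rewrite nth_rcons su ltnn eqxx.
have ua : nth 0 u (size w) = a by rewrite nth_rcons ltnn eqxx.
have ul : 0 < size w -> nth 0 u (size w).-1 = last 0 w.
  by move=> w0; rewrite nth_rcons ltn_predL w0 nth_last.
rewrite /avoids_ge_ge size_rcons su; split=> [av|[av nw] [i [lt_i]]].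
  split=> [[i [lt_i h1 h2]]|].
    by apply: av; exists i; rewrite !nr ?su; try lia; split=> //; lia.
  apply/negP => /and3P[w0 ba al]; apply: av; exists (size w).-1.
  by rewrite prednK // ub !nr ?su ?ua ?ul; try lia; split=> //; lia.
have [lt_i'|ge_i] := ltnP i.+2 (size w).+1.
  by rewrite !nr ?su; try lia; move=> h1 h2; apply: av; exists i.
have iw : i.+1 = size w by lia.
rewrite iw ub !nr ?su ?ua; try lia.
by rewrite (_ : i = (size w).-1) ?ul; lia.
Qed.

(** Duplicate-free list of the avoiding words, split by whether the last step is an ascent. If it is
    not, the step before it must be one, hence the recursion two lengths back through [up w]. *)
Fixpoint words n : seq (seq nat) :=
  if n is n'.+1 then
    [seq up w | w <- words n'] ++
    (if n' is n''.+1 then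
       [seq rcons (up w) i | w <- words n'', i <- iota 0 (height w).+1]
     else [::])
  else [:: [::]].

Lemma wordsS n :
  words n.+2 = [seq up w | w <- words n.+1] ++
    [seq rcons (up w) i | w <- words n, i <- iota 0 (height w).+1].
Proof. by []. Qed.

(** After a nonempty word the appended letter exceeds its predecessor, so it cannot complete a
    forbidden triple. *)
Lemma avoids_up w : avoids_ge_ge (up w) <-> avoids_ge_ge w.
Proof.
rewrite /up; case/lastP: w => [|w a]; first by split=> _; apply: avoids_small.
rewrite avoids_rcons2 height_rcons ltnn andbF /=.
by split=> [[]|].
Qed.

Lemma mem_words n w :
  w \in words n <-> [/\ size w = n, catalan w & avoids_ge_ge w].
Proof.
elim/ltn_ind: n w => -[|[|n]] IH w.
- rewrite inE; split=> [/eqP ->|[/size0nil ->]//].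
  by split=> //; exact: avoids_small.
- rewrite /= inE; split=> [/eqP ->|[]].
    by split=> //; exact: avoids_small.
  by case: w => [|a [|]] // _ [/= -> _] _.
rewrite wordsS mem_cat; split=> [/orP[/mapP[u]|/allpairsPdep[u [i []]]]|].
- move=> /IH[] // su cu au ->; rewrite size_rcons su; split=> //.
    exact/catalan_rcons.
  exact/avoids_up.
- move=> /IH[] // su cu au; rewrite mem_iota ltnS /= => hi ->.
  rewrite !size_rcons su; split=> //.
    by rewrite catalan_rcons height_rcons; split; [exact/catalan_rcons|lia].
  apply/avoids_rcons2; split; first exact/avoids_up.
  by rewrite /height /nilp; case: posnP => //= _; rewrite ltnn andbF.
case/lastP: w => [|w b]; first by case.
case/lastP: w => [|w a]; first by case.
rewrite !size_rcons => -[[sw] /catalan_rcons[cwa]].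
rewrite height_rcons => ba /avoids_rcons2[awa nw].
have [cw ha] : catalan w /\ a <= height w by apply/catalan_rcons.
case: (ltngtP b a.+1) => [lt_ba|//|->]; last 2 first.
- by lia.
- apply/orP; left; apply/mapP; exists (rcons w a).
    by apply/IH; rewrite // size_rcons sw.
  by rewrite /up height_rcons.
(* Here [b <= a], so avoidance makes [a] exceed the last letter of a nonempty [w], and the Catalan
   bound leaves one value. For empty [w] that bound alone gives 0. *)
have ea : a = height w.
  by move: nw ha; rewrite /height /nilp; case: posnP => /= _; lia.
apply/orP; right; apply/allpairsPdep; exists w, b.
rewrite mem_iota -ea /up -ea; split=> //.
by apply/IH => //; split=> //; apply/avoids_up; rewrite /up -ea.
Qed.

Lemma up_inj : injective up.
Proof. by move=> u w /rcons_inj[]. Qed.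

Lemma words_uniq n : uniq (words n).
Proof.
elim/ltn_ind: n => -[|[|n]] IH //.
rewrite wordsS cat_uniq map_inj_uniq ?IH //; last exact: up_inj.
rewrite allpairs_uniq_dep ?IH //; last 2 first.
- by move=> w _; rewrite iota_uniq.
- by move=> [u i] [w j] _ _ /= /rcons_inj[/up_inj -> ->].
(* The two families are disjoint: in the second one the last letter is at most its predecessor
   [height w], in the first it is larger. *)
rewrite andbT; apply/hasPn => _ /allpairsPdep[w [i [_ + ->]]].
rewrite mem_iota ltnS => /andP[_ hi].
apply/mapP => -[u _] /rcons_inj[<-].
by rewrite /up height_rcons; lia.
Qed.

Lemma catalan_ge_geE n i :
  catalan_ge_ge n i = [set` [seq w <- words n | last 0 w == i]]%classic.
Proof.
apply/seteqP; split=> w /=; rewrite mem_filter.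
  by case=> s c a <-; rewrite eqxx; apply/mem_words.
by case/andP => /eqP <- /mem_words[].
Qed.

Local Open Scope ring_scope.

(** * Coefficients of the generating series *)

Section Coefficients.
Variable K : comNzRingType.
Implicit Types (q v a : K) (f g : fps K).

Lemma coefD f g n : coef (f + g) n = coef f n + coef g n.
Proof. by []. Qed.

Lemma coefB f g n : coef (f - g) n = coef f n - coef g n.
Proof. by []. Qed.

Lemma coefZ a f n : coef (a *: f) n = a * coef f n.
Proof. by []. Qed.

Lemma coefXM f n :
  coef (fps_X * f) n = if n is n'.+1 then coef f n' else 0.
Proof.
case: n => [|n]; first by rewrite /= big_ord1 mul0r.
rewrite /= big_ord_recl mul0r add0r big_ord_recl /= mul1r subSS subn0.
by rewrite big1 ?addr0 // => i _; rewrite mul0r.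
Qed.

(** The coefficient of x^n in [C_ge q v] for positive [n]. At [n = 0] the empty word contributes 1,
    whereas the series has no constant term. *)
Definition weight_sum q v n : K :=
  \sum_(w <- words n) q ^+ inter w * v ^+ last 0%N w.

Lemma coef_C_ge q v n :
  coef (C_ge q v) n = if n == 0%N then 0 else weight_sum q v n.
Proof.
transitivity (\sum_(i \in [set: nat]%classic) v ^+ i * coef (C_last q i) n) => //.
(* The last letter of a Catalan word of length n > 0 is below n, so finitely many [i] contribute. *)
rewrite -(fsbig_widen `I_n) //; last first.
  move=> i [_ /= /negP]; rewrite -leqNgt => le_ni.
  by have /= -> := coef_C_last_eq0 q le_ni; rewrite mulr0.
rewrite -fsbig_ord; case: eqVneq => [->|n0]; first by rewrite big_ord0.
under eq_bigr => i _.
  rewrite /= (negPf n0).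
  rewrite catalan_ge_geE -fsbig_seq ?filter_uniq ?words_uniq // big_filter.
  rewrite big_distrr big_mkcond /=; over.
rewrite exchange_big /=; apply: eq_big_seq => w /mem_words[sw cw _].
have lt_w : (last 0%N w < n)%N.
  rewrite -nth_last (leq_ltn_trans (catalan_nth_le _ cw)) // sw.
  by rewrite ltn_predL lt0n.
rewrite (bigD1 (Ordinal lt_w)) //= eqxx mulrC big1 ?addr0 // => i.
by rewrite -val_eqE /= eq_sym => /negPf ->.
Qed.

(** With [u] in place of an inverse, the identity is polynomial and within reach of [ring]. *)
Lemma geometric_sum (t u : K) m :
  (1 - t) * u = 1 -> \sum_(i <- iota 0 m) t ^+ i = u * (1 - t ^+ m).
Proof.
move=> tu; elim: m => [|m IH]; first by rewrite big_nil subrr mulr0.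
rewrite -addn1 iotaD big_cat big_seq1 /= IH add0n exprD expr1.
have -> : u * (1 - t ^+ m * t) = u * (1 - t ^+ m) + (1 - t) * u * t ^+ m by ring.
by rewrite tu mul1r.
Qed.

Lemma weight_sum1 q v : weight_sum q v 1 = 1.
Proof. by rewrite /weight_sum big_seq1 inter_small //= mul1r. Qed.

(** The summand 1 comes from the word 00. The general recurrence fails here, as the empty word has
    height 0 and not [last + 1]. *)
Lemma weight_sum2 q v : weight_sum q v 2 = v * weight_sum q (q * v) 1 + 1.
Proof.
rewrite weight_sum1 /weight_sum wordsS big_cat /= !big_seq1.
by rewrite !(@inter_rcons [:: 0%N]) ?inter_small //= !mul1r expr1 expr0 mulr1.
Qed.

Lemma weight_sum_rec q v u n :
  (1 - q * v) * u = 1 ->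
  weight_sum q v n.+3 =
  u * weight_sum q q n.+1 + v * weight_sum q (q * v) n.+2
  - q ^+ 2 * v ^+ 2 * u * weight_sum q (q ^+ 2 * v) n.+1.
Proof.
move=> qvu; rewrite addrAC addrC /weight_sum wordsS big_cat big_map big_allpairs_dep.
have hl m w : w \in words m.+1 -> (0 < size w)%N /\ height w = (last 0%N w).+1.
  by case/mem_words => sw _ _; rewrite /height /nilp sw.
congr (_ + _).
  (* An ascent from j replaces [v ^+ j] by [q ^+ j * v ^+ j.+1], that is, [v * (q * v) ^+ j]. *)
  rewrite mulr_sumr; apply: eq_big_seq => w /hl[w0 hw].
  rewrite /up hw inter_rcons // last_rcons (minn_idPl (leqnSn _)).
  by rewrite /= exprMn exprD exprS; ring.
rewrite !mulr_sumr -sumrB; apply: eq_big_seq => w /hl[w0 hw].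
(* With j the last letter of [w], the subtracted part of the geometric sum regroups as q^j
   (qv)^(j+2) = q^2 v^2 (q^2 v)^j. *)
rewrite (eq_big_seq (fun i => q ^+ inter w * q ^+ last 0%N w * (q * v) ^+ i)).
  by rewrite -mulr_sumr (geometric_sum _ _ _ qvu) hw !exprMn !exprS; ring.
move=> i; rewrite mem_iota ltnS hw => /andP[_ hi].
rewrite inter_rcons ?size_rcons // /up inter_rcons // !last_rcons hw.
by rewrite (minn_idPl (leqnSn _)) (minn_idPr hi) !exprD exprMn mulrA.
Qed.

End Coefficients.

Theorem theorem5p1 (K : comUnitRingType) (q v : K)
  (qv_unit : 1 - q * v \is a GRing.unit) :
  C_ge q v =
    fps_X + fps_X ^+ 2
    + (1 - q * v)^-1 *: fps_X ^+ 2 * C_ge q q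
    + v *: fps_X * C_ge q (q * v)
    - (q ^+ 2 * v ^+ 2 / (1 - q * v)) *: fps_X ^+ 2 * C_ge q (q ^+ 2 * v).
Proof.
apply/fpsP => n.
rewrite -!scalerAl (expr2 fps_X) -!(mulrA fps_X) coefB !coefD !coefZ !coefXM.
(* The terms x and x^2 supply the coefficients of degree 1 and the word 00 in degree 2. The products
   with x^2 start to contribute in degree 3. *)
case: n => [|[|[|n]]]; rewrite ?coefXM !coef_C_ge /=.
- by rewrite !mulr0 !addr0 subr0.
- by rewrite weight_sum1 !mulr0 !addr0 subr0.
- by rewrite weight_sum2 !mulr0 subr0 addr0 add0r addrC.
by rewrite !add0r; exact/weight_sum_rec/mulrV.
Qed.
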